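(* Let $n\geq 2$ be an integer and $\omega_n=e^{2\pi i/n}$. (a) If a sequence of complex numbers $\{z_j\}_{j=0}^\infty$ is symmetrical of order $n$ and $|z_j|\searrow 0$, then for every integer $p\geq 1$ with $n\nmid p$ such that the series $M_p=\sum_{j=0}^{\infty}z_j^p$ converges, one has $M_p=0$. (b) If the sequence has the form $z_{nj+q}=\omega_n^q\,\xi_j$ for $j\ge 0$ and $0\leq q<n$, where $\{\xi_j\}_{j=0}^\infty$ is a sequence of complex numbers with $|\xi_j|\searrow 0$, then the series $M_p=\sum_{j=0}^\infty z_j^p$ converges for every integer $p\geq1$ with $n\nmid p$.
   Context: A sequence of complex numbers $\{z_j\}_{j=0}^\infty$ is symmetrical of order $n$ if, for all $0\leq k\leq n-1$, $\{z_j\}_{j=0}^\infty=\{z_j\omega_n^k\}_{j=0}^\infty$ as sets with repetitions (multisets). The notation $|z_j|\searrow 0$ means that $|z_j|$ is non-increasing in $j$ and tends to $0$. *)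

(* Defs.v *)
From Stdlib Require Import Reals FinFun.
From Coquelicot Require Import Coquelicot.

(* e^{2 pi i / n}, written out by Euler's formula (there is no complex
   exponential in Coquelicot). *)
Definition omega (n : nat) : C :=
  (cos (2 * PI / INR n), sin (2 * PI / INR n))%R.

(* Equality of the families u and v as sets with repetitions: each is a
   re-indexing of the other, so every value has the same (possibly infinite)
   multiplicity in both. *)
Definition same_multiset (u v : nat -> C) : Prop :=
  exists s : nat -> nat, Bijective s /\ forall j : nat, u j = v (s j).

Definition symmetrical (n : nat) (z : nat -> C) : Prop :=
  forall k : nat, (0 <= k <= n - 1)%nat ->
    same_multiset z (fun j => (z j * omega n ^ k)%C).

Definition decreases_to_zero (a : nat -> R) : Prop :=
  (forall j : nat, (a (S j) <= a j)%R) /\ is_lim_seq a 0%R.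

(* Main.v *)
Require Import Defs.
From Stdlib Require Import Reals FinFun List Permutation Lra Lia.
From Coquelicot Require Import Coquelicot.

(** Both parts rest on the same cancellation: when [n] does not divide [p],
    the number [w = omega n ^ p] is different from [1] while [w ^ n = 1].

    For (a), the terms whose modulus exceeds a given threshold [r >= 0] form a
    finite initial segment [0, ..., N-1], by monotonicity. The re-indexing
    [s] with [z j = z (s j) * omega n] preserves moduli, hence permutes that
    segment, and the partial sum [S] of the [p]-th powers over it satisfies
    [S = w * S], so [S = 0] ([psum_superlevel_eq_0]). Such segments are cofinal,
    except when [z] vanishes from some index on, in which case the partial sums
    are eventually equal to the one over the nonzero terms. So infinitely many
    partial sums vanish ([symmetrical_psum_cofinal]), and the limit can only be
    [0]. Absolute convergence is never needed because the permutation moves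
    finitely many terms inside one segment.

    For (b), the [n] terms of one block sum to [xi j ^ p] times the full
    geometric sum [1 + w + ... + w ^ (n-1) = 0]. A partial sum therefore reduces
    to fewer than [n] terms of modulus [Cmod (xi m) ^ p], which tends to [0]
    ([blocks_series_0]). *)

(** * Finite sums *)

(** The sum of the first [N] terms, so that [psum a 0 = 0]. Writing it as a fold
    over a list gives access to invariance under list permutations. *)
Definition psum (a : nat -> C) (N : nat) : C :=
  fold_right Cplus (RtoC 0) (map a (seq 0 N)).

Lemma fold_right_Cplus_app (l l' : list C) :
  fold_right Cplus (RtoC 0) (l ++ l') =
  (fold_right Cplus (RtoC 0) l + fold_right Cplus (RtoC 0) l')%C.
Proof.
  induction l as [|x l IH]; simpl; [|rewrite IH]; ring.
Qed.

Lemma psum_S (a : nat -> C) (N : nat) : psum a (S N) = (psum a N + a N)%C.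
Proof.
  unfold psum.
  rewrite seq_S, map_app, fold_right_Cplus_app; simpl; ring.
Qed.

Lemma psum_ext (a b : nat -> C) (N : nat) :
  (forall j, (j < N)%nat -> a j = b j) -> psum a N = psum b N.
Proof.
  induction N as [|N IH]; intros H; [reflexivity|].
  rewrite !psum_S, IH, H by auto; reflexivity.
Qed.

Lemma psum_mult_l (c : C) (a : nat -> C) (N : nat) :
  psum (fun j => (c * a j)%C) N = (c * psum a N)%C.
Proof.
  induction N as [|N IH]; [unfold psum; simpl|rewrite !psum_S, IH]; ring.
Qed.

Lemma psum_add (a : nat -> C) (m k : nat) :
  psum a (m + k) = (psum a m + psum (fun j => a (m + j)%nat) k)%C.
Proof.
  induction k as [|k IH].
  - rewrite Nat.add_0_r; unfold psum at 3; simpl; ring.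
  - rewrite Nat.add_succ_r, !psum_S, IH; ring.
Qed.

Lemma psum_eq_0 (a : nat -> C) (N : nat) :
  (forall j, (j < N)%nat -> a j = RtoC 0) -> psum a N = RtoC 0.
Proof.
  induction N as [|N IH]; intros H; [reflexivity|].
  rewrite psum_S, IH, H by auto; ring.
Qed.

Lemma Cmod_psum_le (a : nat -> C) (B : R) (N : nat) :
  (forall j, (j < N)%nat -> Cmod (a j) <= B) -> Cmod (psum a N) <= INR N * B.
Proof.
  induction N as [|N IH]; intros H.
  - unfold psum; simpl; rewrite Cmod_0; lra.
  - rewrite psum_S, S_INR.
    pose proof (Cmod_triangle (psum a N) (a N)).
    assert (Cmod (psum a N) <= INR N * B) by auto.
    assert (Cmod (a N) <= B) by auto.
    lra.
Qed.

Lemma fold_right_Cplus_perm (l l' : list C) :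
  Permutation l l' ->
  fold_right Cplus (RtoC 0) l = fold_right Cplus (RtoC 0) l'.
Proof.
  induction 1; simpl; try congruence; ring.
Qed.

Lemma psum_reindex (a : nat -> C) (s : nat -> nat) (N : nat) :
  bFun N s -> Injective s -> psum (fun j => a (s j)) N = psum a N.
Proof.
  intros Hb Hi; unfold psum.
  rewrite <- map_map.
  apply fold_right_Cplus_perm, Permutation_map.
  exact (nat_bijection_Permutation Hb Hi).
Qed.

Lemma psum_geometric (w : C) (N : nat) :
  ((w - 1) * psum (fun j => w ^ j) N)%C = (w ^ N - 1)%C.
Proof.
  induction N as [|N IH].
  - unfold psum; simpl; ring.
  - rewrite psum_S, Cmult_plus_distr_l, IH, Cpow_S; ring.
Qed.

Lemma Cmult_fixed_eq_0 (w x : C) : w <> RtoC 1 -> x = (w * x)%C -> x = RtoC 0.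
Proof.
  intros Hw H.
  assert (Hw' : (w - 1)%C <> RtoC 0).
  { intros E; apply Hw; replace w with (w - 1 + 1)%C by ring; rewrite E; ring. }
  assert (E : ((w - 1) * x)%C = RtoC 0).
  { replace ((w - 1) * x)%C with (w * x - x)%C by ring; rewrite <- H; ring. }
  replace x with (/ (w - 1) * ((w - 1) * x))%C by (field; exact Hw').
  rewrite E; ring.
Qed.

Lemma psum_geometric_eq_0 (w : C) (N : nat) :
  w <> RtoC 1 -> (w ^ N)%C = RtoC 1 -> psum (fun j => (w ^ j)%C) N = RtoC 0.
Proof.
  intros Hw HN; apply (Cmult_fixed_eq_0 w); [exact Hw|].
  pose proof (psum_geometric w N) as E; rewrite HN in E.
  replace (w * psum (fun j => w ^ j) N)%C
    with ((w - 1) * psum (fun j => w ^ j) N + psum (fun j => w ^ j) N)%C by ring.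
  rewrite E; ring.
Qed.

Lemma sum_n_psum (a : nat -> C) (N : nat) :
  @sum_n C_NormedModule a N = psum a (S N).
Proof.
  induction N as [|N IH].
  - rewrite sum_O; unfold psum; simpl; ring.
  - rewrite sum_Sn, IH, (psum_S a (S N)); reflexivity.
Qed.

Lemma is_series_psum (a : nat -> C) (l : C) :
  @is_series C_AbsRing C_NormedModule a l <->
  forall eps : R, 0 < eps ->
    exists N0, forall N, (N0 <= N)%nat -> Cmod (psum a N - l)%C < eps.
Proof.
  unfold is_series; split.
  - intros H eps Heps.
    destruct (proj1 (filterlim_locally_ball_norm _ _) H (mkposreal eps Heps))
      as [N0 HN0].
    exists (S N0); intros [|N] HN; [lia|].
    rewrite <- sum_n_psum; apply HN0; lia.
  - intros H; apply filterlim_locally_ball_norm; intros [eps Heps].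
    destruct (H eps Heps) as [N0 HN0].
    exists N0; intros N HN.
    unfold ball_norm; rewrite sum_n_psum; apply HN0; lia.
Qed.

(** * Powers of the primitive root of unity *)

Lemma omega_pow (n k : nat) :
  (omega n ^ k)%C =
  (cos (INR k * (2 * PI / INR n)), sin (INR k * (2 * PI / INR n))).
Proof.
  induction k as [|k IH].
  - simpl; rewrite Rmult_0_l, cos_0, sin_0; reflexivity.
  - rewrite Cpow_S, IH, S_INR, Rmult_plus_distr_r, Rmult_1_l, cos_plus, sin_plus.
    unfold omega, Cmult; simpl; f_equal; ring.
Qed.

Lemma omega_pow_n (n : nat) : (0 < n)%nat -> (omega n ^ n)%C = RtoC 1.
Proof.
  intros Hn; rewrite omega_pow.
  assert (INR n <> 0) by (apply not_0_INR; lia).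
  replace (INR n * (2 * PI / INR n)) with (2 * PI) by (field; assumption).
  rewrite cos_2PI, sin_2PI; reflexivity.
Qed.

Lemma Cmod_omega (n : nat) : Cmod (omega n) = 1.
Proof.
  unfold Cmod, omega; simpl fst; simpl snd.
  rewrite <- sqrt_1; f_equal.
  pose proof (sin2_cos2 (2 * PI / INR n)) as H; unfold Rsqr in H; lra.
Qed.

(** With [t = PI p / n], the equality [omega n ^ p = 1] gives [cos (2 t) = 1],
    so [sin t = 0] and [t] is an integer multiple of [PI]. *)
Lemma omega_pow_neq_1 (n p : nat) :
  (0 < n)%nat -> ~ Nat.divide n p -> (omega n ^ p)%C <> RtoC 1.
Proof.
  intros Hn Hp E.
  assert (Hn0 : INR n <> 0) by (apply not_0_INR; lia).
  rewrite omega_pow in E; apply (f_equal fst) in E; simpl in E.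
  replace (INR p * (2 * PI / INR n)) with (2 * (PI * INR p / INR n)) in E
    by (field; exact Hn0).
  rewrite cos_2a_sin in E.
  assert (Hs : sin (PI * INR p / INR n) = 0) by nra.
  destruct (sin_eq_0_0 _ Hs) as [k Hk].
  pose proof PI_RGT_0 as Hpi.
  assert (Hkn : INR p = IZR k * INR n).
  { apply (Rmult_eq_reg_l PI); [|lra].
    replace (PI * (IZR k * INR n)) with ((IZR k * PI) * INR n) by ring.
    rewrite <- Hk; field; exact Hn0. }
  rewrite !INR_IZR_INZ, <- mult_IZR in Hkn; apply eq_IZR in Hkn.
  apply Hp; exists (Z.to_nat k); nia.
Qed.

(** * Symmetrical sequences *)

Lemma decreasing_le (a : nat -> R) :
  (forall j, a (S j) <= a j) -> forall i j, (i <= j)%nat -> a j <= a i.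
Proof.
  intros Ha i j Hij; induction Hij as [|j _ IH]; [lra|].
  specialize (Ha j); lra.
Qed.

Lemma decreasing_superlevel_initial (a : nat -> R) (r : R) (m : nat) :
  (forall j, a (S j) <= a j) -> a m <= r ->
  exists N, forall j, (j < N)%nat <-> r < a j.
Proof.
  intros Ha; induction m as [|m IH]; intros Hm.
  - exists 0%nat; intros j; split; [lia|].
    pose proof (decreasing_le a Ha 0 j ltac:(lia)); lra.
  - destruct (Rle_lt_dec (a m) r) as [Hle|Hlt]; [auto|].
    exists (S m); intros j; split; intros Hj.
    + pose proof (decreasing_le a Ha j m ltac:(lia)); lra.
    + destruct (Nat.lt_ge_cases j (S m)) as [|Hge]; [assumption|].
      pose proof (decreasing_le a Ha (S m) j Hge); lra.
Qed.

(** The re-indexing given by a rotation preserves moduli, hence permutes the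
    finite set of indices above a threshold; the sum over that set is thus
    multiplied by [omega n ^ p] and unchanged at the same time. *)
Lemma psum_superlevel_eq_0 (n p N : nat) (r : R) (z : nat -> C) :
  (2 <= n)%nat -> ~ Nat.divide n p -> symmetrical n z ->
  (forall j, (j < N)%nat <-> r < Cmod (z j)) ->
  psum (fun j => (z j ^ p)%C) N = RtoC 0.
Proof.
  intros Hn Hp Hz HN.
  destruct (Hz 1%nat ltac:(lia)) as [s [[g [Hgs _]] Hs]].
  assert (Hinj : Injective s).
  { intros x y E; rewrite <- (Hgs x), <- (Hgs y), E; reflexivity. }
  assert (Hmod : forall j, Cmod (z (s j)) = Cmod (z j)).
  { intros j; rewrite (Hs j), Cmod_mult, Cmod_pow, Cmod_omega; ring. }
  assert (Hb : bFun N s).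
  { intros j Hj; apply HN; rewrite Hmod; apply HN; exact Hj. }
  apply (Cmult_fixed_eq_0 (omega n ^ p)).
  - apply omega_pow_neq_1; [lia|exact Hp].
  - rewrite <- (psum_reindex (fun j => (z j ^ p)%C) s N Hb Hinj) at 2.
    rewrite <- psum_mult_l; apply psum_ext; intros j _.
    rewrite (Hs j), Cpow_1_r, Cpow_mult_l; ring.
Qed.

Lemma symmetrical_psum_cofinal (n p : nat) (z : nat -> C) :
  (2 <= n)%nat -> (1 <= p)%nat -> ~ Nat.divide n p -> symmetrical n z ->
  decreases_to_zero (fun j => Cmod (z j)) ->
  forall m, exists N, (m <= N)%nat /\ psum (fun j => (z j ^ p)%C) N = RtoC 0.
Proof.
  intros Hn Hp1 Hp Hz [Hdec Hlim] m.
  destruct (Rle_lt_dec (Cmod (z m)) 0) as [H0|Hpos].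
  - (* The sequence vanishes from index m on: threshold 0 cuts it at its
       first zero, and the later terms contribute nothing. *)
    destruct (decreasing_superlevel_initial _ 0 m Hdec H0) as [N HN].
    exists m; split; [lia|].
    assert (HNm : (N <= m)%nat).
    { destruct (Nat.le_gt_cases N m) as [|Hlt]; [assumption|].
      apply HN in Hlt; lra. }
    replace m with (N + (m - N))%nat by lia.
    rewrite psum_add, (psum_superlevel_eq_0 n p N 0 z Hn Hp Hz HN), psum_eq_0.
    + ring.
    + intros j _.
      assert (Hj : z (N + j)%nat = RtoC 0).
      { apply Cmod_eq_0, Rle_antisym; [|apply Cmod_ge_0].
        apply Rnot_lt_le; intros Hlt; apply HN in Hlt; lia. }
      destruct p as [|p]; [lia|].
      rewrite Hj, Cpow_S; ring.
  - (* Half the modulus at m is a threshold whose segment contains m. *)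
    destruct (proj2 (is_lim_seq_spec _ _) Hlim
                (mkposreal (Cmod (z m) / 2) ltac:(lra))) as [K HK].
    specialize (HK K ltac:(lia)); simpl in HK.
    assert (HK' : Cmod (z K) <= Cmod (z m) / 2).
    { pose proof (Rle_abs (Cmod (z K) - 0)); lra. }
    destruct (decreasing_superlevel_initial _ _ K Hdec HK') as [N HN].
    exists N; split.
    + apply Nat.lt_le_incl, HN; lra.
    + exact (psum_superlevel_eq_0 n p N _ z Hn Hp Hz HN).
Qed.

Lemma series_0_of_psum_cofinal (a : nat -> C) (M : C) :
  @is_series C_AbsRing C_NormedModule a M ->
  (forall m, exists N, (m <= N)%nat /\ psum a N = RtoC 0) ->
  M = RtoC 0.
Proof.
  intros HM Ha.
  apply Cmod_eq_0, Rle_antisym; [|apply Cmod_ge_0].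
  apply Rnot_lt_le; intros Hpos.
  destruct (proj1 (is_series_psum a M) HM _ Hpos) as [N0 HN0].
  destruct (Ha N0) as [N [HN E]].
  specialize (HN0 N HN); rewrite E in HN0.
  replace (0 - M)%C with (- M)%C in HN0 by ring.
  rewrite Cmod_opp in HN0; lra.
Qed.

(** * Sequences made of rotated blocks *)

(** Full blocks cancel, so the partial sum up to [n * m + r] only retains the
    [r] terms of the last, incomplete block. *)
Lemma blocks_psum (n p : nat) (z xi : nat -> C) :
  (0 < n)%nat -> ~ Nat.divide n p ->
  (forall j q, (0 <= q < n)%nat -> z (n * j + q)%nat = (omega n ^ q * xi j)%C) ->
  forall m r,
    psum (fun j => (z j ^ p)%C) (n * m + r) =
    psum (fun q => (z (n * m + q)%nat ^ p)%C) r.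
Proof.
  intros Hn Hp Hz m r.
  rewrite psum_add.
  enough (E : psum (fun j => (z j ^ p)%C) (n * m) = RtoC 0)
    by (rewrite E; ring).
  clear r; induction m as [|m IH].
  - rewrite Nat.mul_0_r; reflexivity.
  - rewrite Nat.mul_succ_r, psum_add, IH.
    rewrite (psum_ext _ (fun q => (xi m ^ p * (omega n ^ p) ^ q)%C)).
    + rewrite psum_mult_l, psum_geometric_eq_0.
      * ring.
      * apply omega_pow_neq_1; assumption.
      * rewrite <- Cpow_mult_r, Nat.mul_comm, Cpow_mult_r, omega_pow_n by exact Hn.
        apply Cpow_1_l.
    + intros q Hq.
      rewrite Hz by lia.
      rewrite Cpow_mult_l, <- !Cpow_mult_r, (Nat.mul_comm q p); ring.
Qed.

Lemma pow_le_self (x : R) (p : nat) : (1 <= p)%nat -> 0 <= x <= 1 -> x ^ p <= x.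
Proof.
  intros Hp Hx; destruct p as [|p]; [lia|]; simpl.
  pose proof (pow_incr x 1 p Hx) as H; rewrite pow1 in H.
  pose proof (pow_le x p (proj1 Hx)); nra.
Qed.

Lemma blocks_series_0 (n p : nat) (z xi : nat -> C) :
  (0 < n)%nat -> (1 <= p)%nat -> ~ Nat.divide n p ->
  is_lim_seq (fun j => Cmod (xi j)) 0 ->
  (forall j q, (0 <= q < n)%nat -> z (n * j + q)%nat = (omega n ^ q * xi j)%C) ->
  @is_series C_AbsRing C_NormedModule (fun j => (z j ^ p)%C) (RtoC 0).
Proof.
  intros Hn Hp1 Hp Hlim Hz; apply is_series_psum; intros eps Heps.
  assert (Hn0 : 0 < INR n) by (apply lt_0_INR; exact Hn).
  (* Below 1 a p-th power is at most its base, so a bound on Cmod (xi m)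
     itself suffices for the fewer than n leftover terms. *)
  assert (Hd : 0 < Rmin 1 (eps / INR n)).
  { apply Rmin_glb_lt; [lra|apply Rdiv_lt_0_compat; assumption]. }
  destruct (proj2 (is_lim_seq_spec _ _) Hlim (mkposreal _ Hd)) as [K HK].
  exists (n * K)%nat; intros N HN.
  pose proof (Nat.div_mod_eq N n) as EN.
  pose proof (Nat.mod_upper_bound N n ltac:(lia)) as Hr.
  assert (Hm : (K <= N / n)%nat) by (apply Nat.div_le_lower_bound; lia).
  specialize (HK _ Hm); simpl in HK.
  set (m := (N / n)%nat) in *; set (r := (N mod n)%nat) in *.
  pose proof (Cmod_ge_0 (xi m)) as Hx0.
  rewrite Rminus_0_r, Rabs_pos_eq in HK by exact Hx0.
  pose proof (Rmin_l 1 (eps / INR n)); pose proof (Rmin_r 1 (eps / INR n)).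
  rewrite EN, (blocks_psum n p z xi Hn Hp Hz).
  unfold Cminus; rewrite <- RtoC_opp, Ropp_0, Cplus_0_r.
  apply Rle_lt_trans with (INR r * Cmod (xi m)).
  - apply Cmod_psum_le; intros q Hq.
    rewrite Hz by lia.
    rewrite Cmod_pow, Cmod_mult, Cmod_pow, Cmod_omega, pow1, Rmult_1_l.
    apply pow_le_self; [exact Hp1|lra].
  - apply Rle_lt_trans with (INR n * Cmod (xi m)).
    + apply Rmult_le_compat_r; [exact Hx0|apply le_INR; lia].
    + replace eps with (INR n * (eps / INR n)) by (field; lra).
      apply Rmult_lt_compat_l; lra.
Qed.

(** * Vanishing and convergence of the power sums *)

Theorem lemma2p2 :
  forall n : nat, (2 <= n)%nat ->
    (forall z : nat -> C,
        symmetrical n z ->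
        decreases_to_zero (fun j => Cmod (z j)) ->
        forall p : nat, (1 <= p)%nat -> ~ Nat.divide n p ->
        forall M : C, is_series (fun j => (z j ^ p)%C) M -> M = RtoC 0)
    /\
    (forall z xi : nat -> C,
        decreases_to_zero (fun j => Cmod (xi j)) ->
        (forall j q : nat, (0 <= q < n)%nat ->
            z (n * j + q)%nat = (omega n ^ q * xi j)%C) ->
        forall p : nat, (1 <= p)%nat -> ~ Nat.divide n p ->
        ex_series (fun j => (z j ^ p)%C)).
Proof.
  intros n Hn; split.
  - intros z Hz Hdec p Hp1 Hp M HM.
    apply (series_0_of_psum_cofinal _ M HM).
    exact (symmetrical_psum_cofinal n p z Hn Hp1 Hp Hz Hdec).
  - intros z xi [_ Hlim] Hz p Hp1 Hp.
    exists (RtoC 0).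
    apply (blocks_series_0 n p z xi); [lia|assumption..].
Qed.
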